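(* Let $(X,\mathbb{U})$ be a pre-Lindelöf uniform space with $|X|<\operatorname{cov}(\mathcal{M})$. Then $(X,\mathbb{U})$ is ${\sf R}$-bounded.
   Context: A uniformity on a set $X$ is a nonempty family $\mathbb{U}$ of symmetric subsets of $X\times X$ containing the diagonal $\Delta=\{(x,x):x\in X\}$ (entourages) such that: (i) if $U\in\mathbb{U}$ and $V\supseteq U$ is a symmetric subset of $X\times X$, then $V\in\mathbb{U}$; (ii) $U,V\in\mathbb{U}$ implies $U\cap V\in\mathbb{U}$; (iii) for every $U\in\mathbb{U}$ there is $V\in\mathbb{U}$ with $V\circ V\subseteq U$; (iv) $\bigcap\mathbb{U}=\Delta$. The pair $(X,\mathbb{U})$ is a uniform space. For $U\in\mathbb{U}$, $x\in X$, $F\subseteq X$: $U[x]=\{y\in X:(x,y)\in U\}$ and $U[F]=\bigcup_{x\in F}U[x]$. $(X,\mathbb{U})$ is pre-Lindelöf if for each $U\in\mathbb{U}$ there is a countable $A\subseteq X$ with $U[A]=X$. $(X,\mathbb{U})$ is ${\sf R}$-bounded (Rothberger-bounded) if for each sequence $(U_n)_{n\in\mathbb{N}}$ of members of $\mathbb{U}$ there is a sequence $(x_n)$ of members of $X$ such that $\bigcup_{n\in\mathbb{N}}U_n[x_n]=X$; the empty space is regarded as ${\sf R}$-bounded. $\operatorname{cov}(\mathcal{M})$ is the minimum cardinality of a family of meager subsets of $\mathbb{R}$ that covers $\mathbb{R}$. Equivalently (a known result), it is the minimum cardinality of a set $F\subseteq\mathbb{N}^{\mathbb{N}}$ such that for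 every $g\in\mathbb{N}^{\mathbb{N}}$ there is $f\in F$ with $f(n)\neq g(n)$ for all but finitely many $n$. *)

(* Defs.v *)
From mathcomp Require Import all_boot all_order all_algebra.
From mathcomp Require Import all_classical all_reals all_analysis.

Import numFieldNormedType.Exports.

Local Open Scope classical_set_scope.
Local Open Scope card_scope.

(* The library's entourages form a filter on X * X and need not be symmetric;
   here a uniformity consists of the symmetric ones only. The filter is
   recovered as the family of supersets of its symmetric members. *)
Definition uniformity (X : uniformType) : set (set (X * X)) :=
  [set U | entourage U /\ (U^-1)%relation = U].

(* Separation is not part of [uniformType]. *)
Definition separated_uniformity (X : uniformType) : Prop :=
  \bigcap_(U in uniformity X) U = diagonal.

(* [xsection U x] is U[x] = {y | (x, y) \in U}; [countable] includes finite. *)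
Definition pre_Lindelof (X : uniformType) : Prop :=
  forall U : set (X * X), uniformity X U ->
    exists2 A : set X, countable A & \bigcup_(x in A) xsection U x = [set: X].

Definition R_bounded (X : uniformType) : Prop :=
  [set: X] = set0 \/
  forall U : nat -> set (X * X), (forall n, uniformity X (U n)) ->
    exists x : nat -> X, \bigcup_n xsection (U n) (x n) = [set: X].

Definition nowhere_dense {T : topologicalType} (A : set T) : Prop :=
  interior (closure A) = set0.

Definition meager {T : topologicalType} (A : set T) : Prop :=
  exists2 N : nat -> set T,
    (forall n, nowhere_dense (N n)) & A = \bigcup_n N n.

Definition meager_cover (T : topologicalType) : set (set (set T)) :=
  [set F | (forall M, F M -> meager M) /\ \bigcup_(M in F) M = [set: T]].

Definition card_lt {T U : Type} (A : set T) (B : set U) : Prop :=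
  A #<= B /\ A #!= B.

(* The library has no type of cardinals: cov(M) is represented by a chosen
   covering family of least cardinality. *)
Definition covM (R : realType) : set (set R) :=
  xget set0 [set F | meager_cover R F /\
                     forall G, meager_cover R G -> F #<= G].

(* Zorn's lemma is applied to sets S of choice functions any two of which
   differ at every member of C. *)
Lemma card_min_exists (T : Type) (C : set (set T)) : C !=set0 ->
  exists2 A, C A & forall B, C B -> A #<= B.
Proof.
move=> [A0 CA0].
pose P (S : set (set T -> T)) :=
  (forall p A, S p -> C A -> A (p A)) /\
  (forall p q A, S p -> S q -> C A -> p A = q A -> p = q).
have [F FP Ftot|S [[Smem Sinj] Smax]] := @Zorn_bigcup _ P.
  split=> [p A [S FS Sp] CA|p q A [S FS Sp] [S' FS' S'q] CA pq].
    by have [Smem _] := FP _ FS; exact: Smem Sp CA.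
  have [SS'|S'S] := Ftot _ _ FS FS'.
    by have [_ Sinj] := FP _ FS'; exact: Sinj (SS' _ Sp) S'q CA pq.
  by have [_ Sinj] := FP _ FS; exact: Sinj Sp (S'S _ S'q) CA pq.
have [A [CA AS]] : exists A, C A /\ A `<=` (fun p : set T -> T => p A) @` S.
  apply: contrapT => noA.
  have ex A : C A -> exists a, A a /\ forall p, S p -> p A <> a.
    move=> CA; apply: contrapT => noa; apply: noA; exists A; split=> // a Aa.
    apply: contrapT => Sa; apply: noa; exists a; split=> // p Sp pa.
    by apply: Sa; exists p.
  have [t0 _] := ex _ CA0.
  have /choice[p0 p0P] A : exists a, C A -> A a /\ forall p, S p -> p A <> a.
    have [/ex[a aP]|nCA] := pselect (C A); first by exists a.
    by exists t0.
  have Sp0 : ~ S p0 by move=> Sp; have [_ /(_ _ Sp)] := p0P _ CA0; apply.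
  apply: (Smax (p0 |` S)).
    by split; [move=> p Sp; right | move/(_ p0 (or_introl erefl))].
  split=> [p A [->|Sp] CA|p q A [->|Sp] [->|Sq] CA //].
  - by have [] := p0P _ CA.
  - exact: Smem Sp CA.
  - by move/esym; have [_ /(_ _ Sq)] := p0P _ CA.
  - by have [_ /(_ _ Sp)] := p0P _ CA.
  - exact: Sinj Sp Sq CA.
exists A => // B CB.
apply: card_le_trans (subset_card_le AS) _.
apply: card_le_trans (card_image_le _ _) _.
have /inj_card_eq : {in S &, injective (fun p : set T -> T => p B)}.
  by move=> p q /set_mem Sp /set_mem Sq; exact: Sinj Sp Sq CB.
rewrite card_eq_le => /andP[_ /card_le_trans]; apply.
by apply: subset_card_le => _ [p Sp <-]; exact: Smem Sp CB.
Qed.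

Lemma covMP (R : realType) :
  meager_cover R (covM R) /\ forall G, meager_cover R G -> covM R #<= G.
Proof.
have [|F FC Fmin] := card_min_exists _ (meager_cover R).
  exists [set M | meager M]; split=> //; apply/seteqP; split=> // x _.
  exists [set x] => //; exists (fun=> [set x]); last first.
    by apply/seteqP; split=> [y xy|y [_ _ //]]; exists 0%N.
  move=> _; have /closure_id cl : closed [set x].
    exact/accessible_closed_set1/hausdorff_accessible/Rhausdorff.
  by rewrite /nowhere_dense -cl interior_set1.
have cov : exists F, [set F | meager_cover R F /\
    forall G, meager_cover R G -> F #<= G] F by exists F.
by have := xgetPex set0 cov.
Qed.

(* Main.v *)
Require Import Defs.
From mathcomp Require Import all_boot all_order all_algebra.
From mathcomp Require Import all_classical all_reals all_analysis.
From mathcomp Require Import lra.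

Import Order.TTheory GRing.Theory Num.Theory.
Import numFieldNormedType.Exports.

Local Open Scope classical_set_scope.

(** Enumerate for every n a countable set a_n(0), a_n(1), ... with
    U_n[{a_n(k) : k}] = X, and for x in X let f_x(n) be some k with
    x in U_n[a_n(k)].  It suffices to find g in N^N that agrees with every f_x
    somewhere.  For this N^N is parametrized by the reals, g_r(n) being
    [(saw n r).-1], in such a way that every set M_f of reals r such that g_r and
    f differ everywhere is nowhere dense.  If no g_r worked, the sets M_{f_x}
    would form a meager cover of R with at most |X| < cov(M) members. *)

Section real_line.
Variable R : realType.
Local Open Scope ring_scope.

(* [saw n] takes every positive value on a set with nonempty interior in each
   interval (m/(n+1), (m+1)/(n+1)); at m/(n+1) it is 0, because 0^-1 = 0. *)
Definition saw (n : nat) (r : R) : nat :=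
  Num.truncn (n.+1%:R * r - (Num.floor (n.+1%:R * r))%:~R)^-1.

(** The fractional part of [n.+1%:R * r] lies between 1/(k+2) and 1/(k+1), so its inverse lies
    between k+1 and k+2. *)
Lemma saw_eq (n k : nat) (m : int) (r : R) :
  m%:~R + k.+2%:R^-1 < n.+1%:R * r -> n.+1%:R * r < m%:~R + k.+1%:R^-1 ->
  saw n r = k.+1.
Proof.
have k2 : 0 < k.+2%:R^-1 :> R by rewrite invr_gt0.
have k1 : k.+1%:R^-1 <= 1 :> R by rewrite invf_le1 ?ler1n.
rewrite /saw; move: (n.+1%:R * r) => y lo hi.
have flr : Num.floor y = m.
  apply: floor_def; rewrite intrD mulr1z; apply/andP; split.
    by rewrite ltW// (lt_trans _ lo)// ltrDl.
  by rewrite (lt_le_trans hi)// lerD2l.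
rewrite flr; set t := y - _.
have t_lo : k.+2%:R^-1 < t by rewrite ltrBrDl.
have t_hi : t < k.+1%:R^-1 by rewrite ltrBlDl.
have t0 : 0 < t by exact: lt_trans t_lo.
apply: truncn_def; apply/andP; split.
  by rewrite ltW// -[ltLHS]invrK ltf_pV2// posrE invr_gt0.
by rewrite -[ltRHS]invrK ltf_pV2// posrE invr_gt0.
Qed.

(** [n] must not depend on [k]: the value to be hit will be [(f n).+1], known only once [n] is. *)
Lemma saw_fiber_itv (a b : R) : a < b ->
  exists n, forall k, exists c d,
    [/\ a < c, c < d, d < b & forall r, c < r < d -> saw n r = k.+1].
Proof.
(* Scaled by n+1 the interval is longer than 2, so it contains some [m, m+1] with m an integer. *)
move=> ab; have [n nP] : exists n, 2 / (b - a) < n.+1%:R.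
  exists (Num.truncn (2 / (b - a))); exact: truncnS_gt.
(* N, p and q are opaque so that [lra] treats them as atoms. *)
have [N NE] : exists N : R, N = n.+1%:R by exists n.+1%:R.
have N0 : 0 < N by rewrite NE ltr0n.
rewrite -NE in nP; exists n => k.
have {}nP : 2 < N * b - N * a.
  by rewrite -mulrBr -ltr_pdivrMr// subr_gt0.
have /andP[flo fhi] := floor_itv (N * a).
set m := Num.floor (N * a) + 1 in fhi.
have mE : m%:~R = (Num.floor (N * a))%:~R + 1 :> R by rewrite intrD mulr1z.
rewrite mE in fhi.
have [p pE] : exists p : R, p = k.+2%:R^-1 by exists k.+2%:R^-1.
have [q qE] : exists q : R, q = k.+1%:R^-1 by exists k.+1%:R^-1.
have p0 : 0 < p by rewrite pE invr_gt0.
have q1 : q <= 1 by rewrite qE invf_le1 ?ler1n.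
have pq : p < q by rewrite pE qE ltf_pV2 ?posrE ?ltr0n// ltr_nat.
exists ((m%:~R + p) / N), ((m%:~R + q) / N).
split=> [||| r /andP[]].
- by rewrite ltr_pdivlMr// mulrC mE; lra.
- by rewrite ltr_pM2r ?invr_gt0// ltrD2l.
- by rewrite ltr_pdivrMr// mulrC mE; lra.
- rewrite ltr_pdivrMr// ltr_pdivlMr// ![_ * N]mulrC NE pE qE; exact: saw_eq.
Qed.

Lemma nowhere_dense_saw_neq (f : nat -> nat) :
  nowhere_dense [set r : R | forall n, saw n r <> (f n).+1].
Proof.
apply/seteqP; split=> // x /nbhs_ballP[e /= e0 eM].
have [|n nP] := saw_fiber_itv (x - e) (x + e); first by lra.
have [c [d [ac cd db fib]]] := nP (f n).
have /eM : ball x e ((c + d) / 2).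
  by rewrite -ball_normE /ball_ /= ltr_norml; apply/andP; split; lra.
(* The midpoint is in the closure, so ]c, d[ meets the set, yet [saw n] is [(f n).+1] there. *)
case/(_ `]c, d[%classic).
  by apply: open_nbhs_nbhs; split=> //=; rewrite in_itv/=; apply/andP; split; lra.
by move=> r [/(_ n) neq]; rewrite /= in_itv/= => /fib.
Qed.

End real_line.

Lemma nowhere_dense_meager {T : topologicalType} (A : set T) :
  nowhere_dense A -> meager A.
Proof.
move=> ndA; exists (fun=> A) => //.
by apply/seteqP; split=> [x Ax|x [_ _ //]]; exists 0%N.
Qed.

Lemma countable_sub_range {T : Type} (t0 : T) (A : set T) :
  countable A -> exists a : nat -> T, A `<=` range a.
Proof.
move=> /pcard_leP/unsquash h.
(* [a] inverts the injection [h] on [A]; [t0] fills the indices outside the image, which are all of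
   them if [A] is empty. *)
have /choice[a aP] k : exists y : T, forall x, A x -> h x = k -> y = x.
  have [[x Ax <-]|no] := pselect (exists2 x, A x & h x = k).
    by exists x => y Ay /inj; rewrite !inE => ->.
  by exists t0 => x Ax hx; case: no; exists x.
by exists a => x Ax; exists (h x) => //; exact: aP.
Qed.

Lemma guess_of_card_lt_covM (R : realType) (X : Type) (f : X -> nat -> nat) :
  card_lt [set: X] (covM R) -> exists g : nat -> nat, forall x, exists n, f x n = g n.
Proof.
move=> [leXM neXM]; apply: contrapT => nog.
pose M x := [set r : R | forall n, saw R n r <> (f x n).+1].
have covM_range : meager_cover R (range M).
  split=> [_ [x _ <-]|]; first exact/nowhere_dense_meager/nowhere_dense_saw_neq.
  apply/seteqP; split=> // r _; apply: contrapT => nor.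
  apply: nog; exists (fun n => (saw R n r).-1) => x; apply: contrapT => nox.
  apply: nor; exists (M x); first by exists x.
  by move=> n eqn; apply: nox; exists n; rewrite eqn.
have [_ /(_ _ covM_range) leMX] := covMP R.
(* By Cantor-Bernstein, a cover indexed by [X] would make [X] and [covM R] equinumerous. *)
move/negP: neXM; apply; rewrite card_eq_le leXM.
exact: card_le_trans leMX (card_image_le _ _).
Qed.

Theorem theorem3p5 (R : realType) (X : uniformType) :
  separated_uniformity X -> pre_Lindelof X -> card_lt [set: X] (covM R) -> R_bounded X.
Proof.
move=> _ preL ltX.
have [X0|/set0P[x0 _]] := eqVneq [set: X] set0; [by left|right => U unifU].
have /choice[a aP] n : exists a : nat -> X,
    forall x, exists k, xsection (U n) (a k) x.
  have [A cA covA] := preL _ (unifU n).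
  have [a Aa] := countable_sub_range x0 A cA.
  exists a => x; have [y Ay Uyx] : (\bigcup_(y in A) xsection (U n) y) x.
    by rewrite covA.
  by have [k _ ak] := Aa _ Ay; exists k; rewrite ak.
have /choice[f fP] x : exists f : nat -> nat,
    forall n, xsection (U n) (a n (f n)) x.
  have /choice[k kP] : forall n, exists k, xsection (U n) (a n k) x.
    by move=> n; exact: aP.
  by exists k.
have [g gP] := guess_of_card_lt_covM R X f ltX.
exists (fun n => a n (g n)); apply/seteqP; split=> // x _.
by have [n fg] := gP x; exists n => //; rewrite -fg; exact: fP.
Qed.
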